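(* Let $0 \leq \lambda < 1$ and $n \geq 2$. Then the following hold. (i) If $K, L \subset \mathbb{R}^n$ are convex bodies containing the origin in their interiors and satisfying $G_{K,\lambda}(t) = G_{L,\lambda}(t)$ for all $t \in \mathbb{R}^n$, then $K = L$. (ii) If $K, L \subset \mathbb{R}^n$ are convex bodies containing the origin in their interiors and $G_{K,\lambda}(t)$ depends only on the $L$-norm $\|t\|_L$ of $t$, then $K$ is a homothetic copy of $L$.
   Context: A convex body is a compact convex set with nonempty interior. For a convex body $K \subset \mathbb{R}^n$ containing the origin $o$ in its interior and $\lambda \in [0,1)$, the $\lambda$-homothetic convex hull function $G_{K,\lambda} : \mathbb{R}^n \to \mathbb{R}$ is defined by $G_{K,\lambda}(t) = \operatorname{vol}_n \operatorname{conv}(K \cup (\lambda K + t))$. For a convex body $L$ with $o \in \operatorname{int}(L)$, $\|\cdot\|_L$ is the (possibly asymmetric) norm with unit ball $L$, i.e. $\|t\|_L = \min\{\tau \geq 0 : t \in \tau L\}$. ''$G_{K,\lambda}(t)$ depends only on $\|t\|_L$'' means that $\|s\|_L = \|t\|_L$ implies $G_{K,\lambda}(s) = G_{K,\lambda}(t)$. A homothetic copy of $L$ is a set of the form $x + \mu L$ with $x \in \mathbb{R}^n$ and $\mu \neq 0$. *)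

(* Defs.v *)
From HB Require Import structures.
From mathcomp Require Import all_boot all_order all_algebra.
From mathcomp Require Import all_classical all_reals all_analysis.

Set Implicit Arguments.
Unset Strict Implicit.
Unset Printing Implicit Defensive.

Import Order.TTheory GRing.Theory Num.Theory.
Import numFieldNormedType.Exports.

Local Open Scope classical_set_scope.
Local Open Scope ring_scope.

(* The n-fold product of Lebesgue measure on the line. The sigma-algebra of
   n.-tuple (measurableTypeR R) is generated by the coordinates, hence it is
   the Borel sigma-algebra of R^n. *)
Fixpoint lebesgue_tuple (R : realType) (n : nat) :
    set (n.-tuple (measurableTypeR R)) -> \bar R :=
  match n with
  | 0 => dirac [tuple]
  | m.+1 => pushforward (lebesgue_measure \x @lebesgue_tuple R m)%E
              (fun p => [the m.+1.-tuple (measurableTypeR R) of p.1 :: p.2])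
  end.

Definition volume (R : realType) (n : nat) (A : set 'rV[R]_n) : \bar R :=
  lebesgue_tuple [set t : n.-tuple (measurableTypeR R) |
                   A (\row_(i < n) (tnth t i : R))].

Section ConvexGeometry.
Context {R : realType} {n : nat}.
Implicit Types (A K L : set 'rV[R]_n) (s t x : 'rV[R]_n).

Definition convex_hull A : set 'rV[R]_n := smallest (@convex_set R 'rV[R]_n) A.

Definition convex_body K :=
  [/\ compact K, convex_set K & interior K !=set0].

Definition homothety x (mu : R) A : set 'rV[R]_n :=
  [set x + mu *: y | y in A].

(* [fine] only drops the type of extended reals: the hull is bounded when K is,
   so its volume is finite. *)
Definition hull_function K (lambda : R) t : R :=
  fine (volume (convex_hull (K `|` homothety t lambda K))).

(* When L is a convex body containing the origin in its interior, this infimum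
   is attained. *)
Definition gauge L t : R := inf [set tau : R | 0 <= tau /\ homothety 0 tau L t].

Definition depends_only_on_gauge (G : 'rV[R]_n -> R) L :=
  forall s t, gauge L s = gauge L t -> G s = G t.

Definition homothetic_copy K L :=
  exists x, exists2 mu : R, mu != 0 & K = homothety x mu L.

End ConvexGeometry.

(* Main.v *)
Require Import Defs.
From HB Require Import structures.
From mathcomp Require Import all_boot all_order all_algebra.
From mathcomp Require Import all_classical all_reals all_analysis.
From mathcomp Require Import measurable_realfun ring lra.
Import Order.TTheory GRing.Theory Num.Theory.
Import numFieldNormedType.Exports.
Local Open Scope classical_set_scope.
Local Open Scope ring_scope.

(** The function [hull_function K lambda] attains its minimum, the volume of
    [K], exactly on [(1 - lambda) K], so its minimum level set determines [K].

    Indeed [K] is contained in the hull [H] of [K] and [lambda K + t], and the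
    two coincide if and only if [K] contains [lambda K + t].  By convexity this
    holds when [t] lies in [(1 - lambda) K] ([convex_homothety_sub]).
    Conversely, if the contraction [x |-> lambda x + t] maps the closed set [K]
    to itself, then [K] contains its fixed point [t / (1 - lambda)]
    ([homothety_sub_fixpoint]).  When [H] is larger than [K] it has a larger
    volume: it contains a point [p] outside [K] and a ball around the origin,
    hence small balls close to [p], which miss the closed set [K]
    ([convex_ball_outside], [fine_volume_lt]).  The outcome is
    [hull_function_eq0P].

    If two bodies have the same function, they have the same minimum level set
    and are equal.  If the function of [K] depends only on the gauge of [L],
    then membership of [x] in [K] depends only on the gauge of [x], so it can be
    tested on a single ray, spanned by some [v]; there it is decided by
    comparing with the point where the ray leaves [K].  Hence [K] is [mu L],
    with [mu] the quotient of the gauges of [v] for [L] and for [K]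
    ([hull_function_gauge_homothetic]).

    The volume enters only through three facts: it is monotone, it is finite and
    positive on balls (which are cubes, the norm being the maximum norm), and it
    adds up over a closed set and a ball disjoint from it. *)

Set Implicit Arguments.
Unset Strict Implicit.
Unset Printing Implicit Defensive.

(** * Iterated Lebesgue measure *)

(** The integral of a nonnegative function is a supremum over the simple
    functions below it, so monotonicity does not require measurability.  This
    makes the volume monotone on all sets, and spares a proof that convex hulls
    are measurable. *)
Lemma ge0_integral_homo d (T : measurableType d) (R : realType)
    (mu : {measure set T -> \bar R}) (f g : T -> \bar R) :
  (forall x, 0 <= f x)%E -> (forall x, f x <= g x)%E ->
  (\int[mu]_x f x <= \int[mu]_x g x)%E.
Proof.
move=> f0 fg.
rewrite !ge0_integralTE//; last by move=> x; exact: le_trans (f0 x) (fg x).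
apply: le_ereal_sup => _ [h hf <-]; exists h => // x.
exact: le_trans (hf x) (fg x).
Qed.

Lemma sigma_finite_measure_of d (T : measurableType d) (R : realType)
    (m : set T -> \bar R) :
  m set0 = 0%E -> (forall A, 0 <= m A)%E -> semi_sigma_additive m ->
  sigma_finite setT m ->
  exists mu : {sigma_finite_measure set T -> \bar R},
    mu = m :> (set T -> \bar R).
Proof.
move=> m0 m_ge0 m_sigma m_fin.
pose mM := isMeasure.Build _ _ _ m m0 m_ge0 m_sigma.
pose mm : {measure set T -> \bar R} := HB.pack m mM.
pose mu : {sigma_finite_measure set T -> \bar R} :=
  HB.pack m mM (Measure_isSigmaFinite.Build _ _ _ mm m_fin).
by exists mu.
Qed.

Section LebesgueTuple.
Context {R : realType}.
Local Notation RT := (measurableTypeR R).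

Lemma lebesgue_tuple_ge0 n (A : set (n.-tuple RT)) : (0 <= lebesgue_tuple A)%E.
Proof.
elim: n A => [|n IH] A /=; first exact: measure_ge0.
by apply: integral_ge0 => x _; exact: IH.
Qed.

Lemma le_lebesgue_tuple n (A B : set (n.-tuple RT)) :
  A `<=` B -> (lebesgue_tuple A <= lebesgue_tuple B)%E.
Proof.
elim: n A B => [|n IH] A B AB /=.
  rewrite !diracE lee_fin ler_nat; have [a|//] := boolP (_ \in A).
  by rewrite (mem_set (AB _ (set_mem a))).
apply: ge0_integral_homo => x /=; first exact: lebesgue_tuple_ge0.
by apply: IH => y; rewrite !xsectionE /=; exact: AB.
Qed.

(** The centre is a sequence rather than a tuple, so that dropping its first
    coordinate is a shift. *)
Definition tuple_cube n (c : nat -> R) (r : R) : set (n.-tuple RT) :=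
  [set t | forall i : 'I_n, `|c i - (tnth t i : R)| < r].

Lemma measurable_tuple_cube n c r : measurable (@tuple_cube n c r).
Proof.
rewrite (_ : tuple_cube c r = \bigcap_(i in [set: 'I_n])
    ((fun t : n.-tuple RT => tnth t i) @^-1` (ball (c i) r : set R))).
  apply: fin_bigcap_measurable; first exact: finite_finset.
  move=> i _; rewrite -[X in measurable X]setTI.
  by apply: measurable_tnth => //; exact: measurable_ball.
by apply/seteqP; split=> t /= H i *; apply: H.
Qed.

Lemma tuple_cubeS n c r :
  (fun p : RT * n.-tuple RT => [the n.+1.-tuple RT of p.1 :: p.2])
    @^-1` @tuple_cube n.+1 c r =
  (ball (c 0%N) r : set R) `*` tuple_cube (fun k => c k.+1) r.
Proof.
apply/seteqP; split=> [[x t] /= H|[x t] /= [H0 H] i].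
  split=> [|i /=]; first exact: (H ord0).
  by have := H (lift ord0 i); rewrite tnthS.
by case: (unliftP ord0 i) => [j ->|->]; [rewrite tnthS; exact: H|exact: H0].
Qed.

Lemma bigcup_tuple_cube n : \bigcup_k @tuple_cube n (fun=> 0) k%:R = setT.
Proof.
apply/seteqP; split=> // t _.
exists (Num.truncn (\big[Order.max/0]_(i < n) `|tnth t i : R|)).+1 => // i /=.
rewrite sub0r normrN (le_lt_trans _ (truncnS_gt _))//.
exact: (le_bigmax _ (fun i => `|tnth t i : R|)).
Qed.

(** Sigma-finiteness has to be carried along the induction, because the product
    of two measures is a measure only if the second factor is sigma-finite; it
    comes from the cubes centred at the origin. *)
Lemma lebesgue_tuple_measure n :
  exists2 mu : {sigma_finite_measure set (n.-tuple RT) -> \bar R},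
    mu = @lebesgue_tuple R n :> (set _ -> _) &
    forall c r, 0 < r -> mu (tuple_cube c r) = ((2 * r) ^+ n)%:E.
Proof.
elim: n => [|n [mu muE mu_cube]].
  exists (@dirac _ (0.-tuple RT) [tuple] R) => // c r r0.
  by rewrite expr0 /= diracE mem_set// => -[].
pose F := fun p : RT * n.-tuple RT => [the n.+1.-tuple RT of p.1 :: p.2].
have mF : measurable_fun setT F by exact: measurable_cons.
pose nu := pushforward (lebesgue_measure \x mu)%E F.
have nu0 : nu set0 = 0%E by exact: measure0.
have nu_ge0 A : (0 <= nu A)%E by exact: measure_ge0.
have nu_sigma : semi_sigma_additive nu by exact: measure_semi_sigma_additive.
have nu_cube c r : 0 < r -> nu (tuple_cube c r) = ((2 * r) ^+ n.+1)%:E.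
  move=> r0; rewrite /nu /pushforward tuple_cubeS product_measure1E//.
  - rewrite mu_cube// [X in (X * _)%E](lebesgue_measure_ball _ (ltW r0)).
    by rewrite -EFinM exprS mulr_natl.
  - exact: measurable_ball.
  - exact: measurable_tuple_cube.
have nu_fin : sigma_finite setT nu.
  exists (fun k => tuple_cube (fun=> 0) k.+1%:R).
    apply/seteqP; split=> // t _.
    have [k _ Hk] : (\bigcup_k @tuple_cube n.+1 (fun=> 0) k%:R) t.
      by rewrite bigcup_tuple_cube.
    by exists k => // i; apply: (lt_le_trans (Hk i)); rewrite ler_nat.
  move=> k; split; first exact: measurable_tuple_cube.
  by rewrite nu_cube// ltry.
have [mu' mu'E] := sigma_finite_measure_of nu0 nu_ge0 nu_sigma nu_fin.
by exists mu'; rewrite mu'E// /nu muE.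
Qed.

(** * Volume in the space of row vectors *)

Definition row_of_tuple n (t : n.-tuple RT) : 'rV[R]_n :=
  \row_(i < n) (tnth t i : R).

Lemma mx_ballP n (x y : 'rV[R]_n) r :
  0 < r -> ball x r y <-> forall i, `|x 0 i - y 0 i| < r.
Proof.
move=> r0; split=> [[_ H] i|H]; first exact: H.
by split=> // i j; rewrite ord1; exact: H.
Qed.

Lemma row_of_tuple_ball n (x : 'rV[R]_n) r : 0 < r ->
  exists c : nat -> R, @row_of_tuple n @^-1` ball x r = tuple_cube c r.
Proof.
move=> r0; exists (fun k => if insub k is Some i then x 0 i else 0).
by apply/seteqP; split=> t /= H; [move/(mx_ballP _ _ r0) : H => H i|
   apply/(mx_ballP _ _ r0) => i]; have := H i; rewrite mxE valK.
Qed.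

Definition rat_row n (q : 'rV[rat]_n) : 'rV[R]_n := map_mx ratr q.

(** Rational balls of radius [1 / (k + 1)] form a countable basis.  This is what
    relates the topology of row vectors to the product sigma-algebra. *)
Lemma open_bigcup_rat_ball n (U : set 'rV[R]_n) : open U ->
  U = \bigcup_p [set x | ball (rat_row p.1) p.2.+1%:R^-1 `<=` U
    /\ ball (rat_row p.1) p.2.+1%:R^-1 x].
Proof.
move=> oU; apply/seteqP; split=> [x Ux|x [p _ [+]]]; last by apply.
have /nbhs_ballP[e /= e0 eU] : nbhs x U by exact: open_nbhs_nbhs.
have [k k_lt] : exists k : nat, k.+1%:R^-1 < e / 2.
  exists (Num.truncn (e / 2)^-1); rewrite invf_plt ?posrE ?divr_gt0//.
  exact: truncnS_gt.
have k0 : (0 : R) < k.+1%:R^-1 by rewrite invr_gt0.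
have /choice[q xq] : forall i, exists q : rat,
    ball (x 0 i) k.+1%:R^-1 (ratr q : R).
  move=> i; have ne : ball (x 0 i) k.+1%:R^-1 !=set0.
    by exists (x 0 i); exact: ballxx.
  have [_ [/[swap] -[q _ <-] xq]] := dense_rat ne (ball_open _ _).
  by exists q.
have xqb : ball (rat_row (\row_i q i)) k.+1%:R^-1 x.
  by apply: ball_sym; apply/mx_ballP => // i; rewrite !mxE; exact: xq.
exists (\row_i q i, k) => //=; split=> // y yb; apply: eU.
(* The radius is below e / 2, so a rational ball containing x lies in U. *)
rewrite [e]splitr; apply: (ball_triangle (y := rat_row (\row_i q i))).
  exact: le_ball (ltW k_lt) _ (ball_sym xqb).
exact: le_ball (ltW k_lt) _ yb.
Qed.

Lemma measurable_row_of_tuple_open n (U : set 'rV[R]_n) :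
  open U -> measurable (@row_of_tuple n @^-1` U).
Proof.
move=> /open_bigcup_rat_ball ->; rewrite preimage_bigcup.
apply: countable_bigcupT_measurable => // -[q k] /=.
set b := ball _ _; case: (pselect (b `<=` U)) => bU; last first.
  by rewrite (_ : _ @^-1` _ = set0)// -subset0 => t [].
have /(row_of_tuple_ball (rat_row q))[c bE] : (0 : R) < k.+1%:R^-1.
  by rewrite invr_gt0.
rewrite (_ : _ @^-1` _ = @row_of_tuple n @^-1` b); last first.
  by apply/seteqP; split=> t // [].
by rewrite bE; exact: measurable_tuple_cube.
Qed.

Lemma volume_ball n (x : 'rV[R]_n) r :
  0 < r -> volume (ball x r) = ((2 * r) ^+ n)%:E.
Proof.
move=> r0; have [mu muE mu_cube] := lebesgue_tuple_measure n.
have [c bE] := row_of_tuple_ball x r0.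
by rewrite -(mu_cube c _ r0) muE -bE.
Qed.

Lemma le_volume n (A B : set 'rV[R]_n) : A `<=` B -> (volume A <= volume B)%E.
Proof. by move=> AB; apply: le_lebesgue_tuple => t; exact: AB. Qed.

Lemma volume_fin_num n (A : set 'rV[R]_n) x r :
  0 < r -> A `<=` ball x r -> volume A \is a fin_num.
Proof.
move=> r0 Ar; rewrite ge0_fin_numE; last exact: lebesgue_tuple_ge0.
by apply: le_lt_trans (le_volume Ar) _; rewrite volume_ball// ltry.
Qed.

Lemma volume_setU_ball n (A : set 'rV[R]_n) x r :
  0 < r -> closed A -> A `&` ball x r = set0 ->
  volume (A `|` ball x r) = (volume A + volume (ball x r))%E.
Proof.
move=> r0 cA Ab; have [mu muE _] := lebesgue_tuple_measure n.
rewrite /volume -muE -!/(@row_of_tuple n @^-1` _) preimage_setU measureU//.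
- rewrite -[A]setCK preimage_setC; apply: measurableC.
  exact: (measurable_row_of_tuple_open (closed_openC cA)).
- exact: (measurable_row_of_tuple_open (ball_open x r)).
- by rewrite -preimage_setI Ab preimage_set0.
Qed.

(** The ball around [x] only serves to make the volume of [B], and hence that
    of [A], finite: otherwise [fine] could hide the difference. *)
Lemma fine_volume_lt n (A B : set 'rV[R]_n) x r y e :
  closed A -> A `<=` B -> 0 < r -> B `<=` ball x r ->
  0 < e -> ball y e `<=` B `\` A -> fine (volume A) < fine (volume B).
Proof.
move=> cA AB r0 Br e0 eBA.
have Afin : volume A \is a fin_num.
  exact: volume_fin_num r0 (subset_trans AB Br).
have AUe : volume (A `|` ball y e) = (volume A + volume (ball y e))%E.
  by apply: volume_setU_ball => //; rewrite -subset0 => z [Az /eBA[_]].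
apply: (@lt_le_trans _ _ (fine (volume (A `|` ball y e)))).
  by rewrite AUe volume_ball// fineD//= ltrDl exprn_gt0// mulr_gt0.
apply: fine_le.
- by rewrite AUe volume_ball// fin_numD Afin.
- exact: volume_fin_num r0 Br.
- by apply: le_volume => z [/AB//|/eBA[]].
Qed.

End LebesgueTuple.

(** * Convex sets and their homothetic copies *)

Section Convexity.
Context {R : realType} {n : nat}.
Implicit Types (A K : set 'rV[R]_n) (t x p : 'rV[R]_n).

Lemma convex_setP A : convex_set A <->
  forall x y (a : R), 0 <= a <= 1 -> A x -> A y -> A (a *: x + (1 - a) *: y).
Proof.
split=> [cA x y a /andP[a0 a1] Ax Ay|cA x y a /set_mem Ax /set_mem Ay].
  exact: (set_mem (cA x y (Itv01 a0 a1) (mem_set Ax) (mem_set Ay))).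
by apply: mem_set; apply: cA => //; rewrite ge0 le1.
Qed.

Lemma convex_set_hull A : convex_set (convex_hull A).
Proof.
apply/convex_setP => x y a a01 Ax Ay B AB.
by apply: ((convex_setP B).1 AB.1 x y a a01); [exact: Ax|exact: Ay].
Qed.

Lemma convex_set_ball0 (r : R) : convex_set (ball (0 : 'rV[R]_n) r).
Proof.
apply/convex_setP => x y a /andP[a0 a1].
rewrite -ball_normE /= !sub0r !normrN => xr yr.
rewrite (le_lt_trans (ler_normD _ _))// !normrZ !ger0_norm ?subr_ge0//.
have [xy|yx] := leP `|x| `|y|; nra.
Qed.

Lemma convex_scale A x (a : R) :
  convex_set A -> A 0 -> 0 <= a <= 1 -> A x -> A (a *: x).
Proof.
move=> /convex_setP cA A0 a01 Ax; have := cA x 0 a a01 Ax A0.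
by rewrite scaler0 addr0.
Qed.

(** [t + lambda y] is the convex combination of [t / (1 - lambda)] and [y] with
    weights [1 - lambda] and [lambda]. *)
Lemma convex_homothety_sub K t (lambda : R) :
  convex_set K -> 0 <= lambda < 1 -> K ((1 - lambda)^-1 *: t) ->
  homothety t lambda K `<=` K.
Proof.
move=> /convex_setP cK /andP[l0 l1] Kt _ [y Ky <-].
have l01 : 0 <= lambda <= 1 by rewrite l0 ltW.
have l0' : 1 - lambda != 0 by rewrite gt_eqF// subr_gt0.
by have := cK y _ lambda l01 Ky Kt; rewrite scalerA divff// scale1r addrC.
Qed.

(** The iterates of [x |-> lambda x + t] from the origin are the partial sums of
    the geometric series, times [t]; they stay in [K] and converge to the fixed
    point. *)
Lemma homothety_sub_fixpoint K t (lambda : R) :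
  closed K -> K 0 -> 0 <= lambda < 1 -> homothety t lambda K `<=` K ->
  K ((1 - lambda)^-1 *: t).
Proof.
move=> cK K0 /andP[l0 l1] subK.
pose u k := series (geometric 1 lambda) k *: t.
have Ku k : K (u k).
  elim: k => [|k IH]; first by rewrite /u seriesEnat /= big_geq// scale0r.
  apply: subK; exists (u k) => //.
  rewrite /u scalerA -[X in X + _]scale1r -scalerDl; congr (_ *: _).
  rewrite !seriesEnat /= big_nat_recl//= expr0 mulr1; congr (_ + _).
  by rewrite mulr_sumr; apply: eq_bigr => i _; rewrite /= !mul1r exprS.
apply: (closed_cvg K cK (u_ := u) (F := \oo)) => //.
  by near=> k; exact: Ku.
apply: cvgZr_tmp.
rewrite -[(1 - lambda)^-1]mul1r; apply: cvg_geometric_series.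
by rewrite ger0_norm.
Unshelve. all: by end_near. Qed.

(** The homothety of centre [p] and ratio [s] maps a ball around the origin to a
    ball contained in [H]; when [s] is small, that ball is close to [p] and so
    misses [K]. *)
Lemma convex_ball_outside K (H : set 'rV[R]_n) p :
  closed K -> convex_set H -> interior H 0 -> H p -> ~ K p ->
  exists y, exists2 e : R, 0 < e & ball y e `<=` H `\` K.
Proof.
move=> cK /convex_setP cH /nbhs_ballP[r /= r0 rH] Hp Kp.
have /nbhs_ballP[d /= d0 dK] : nbhs p (~` K).
  by apply: open_nbhs_nbhs; split => //; exact: closed_openC.
(* Points of the new ball are at distance less than s (r + |p|) from p; this
   choice of s makes that bound smaller than d, and s smaller than 1. *)
pose D := d + r + `|p|; pose s := d / D.
have D0 : 0 < D by rewrite /D; have := normr_ge0 p; lra.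
have s0 : 0 < s by rewrite divr_gt0.
have sD : s * D = d by rewrite /s divfK// gt_eqF.
have s1 : s < 1 by rewrite /s ltr_pdivrMr// mul1r /D; have := normr_ge0 p; lra.
exists ((1 - s) *: p), (s * r); first by rewrite mulr_gt0.
move=> z; rewrite -ball_normE /= => zb; split; last first.
  apply: dK; rewrite -ball_normE /=.
  have -> : p - z = s *: p + ((1 - s) *: p - z).
    by rewrite addrA -scalerDl subrKC scale1r.
  rewrite (le_lt_trans (ler_normD _ _))// normrZ gtr0_norm//.
  by move: sD; rewrite /D; nra.
have -> : z = s *: (s^-1 *: (z - (1 - s) *: p)) + (1 - s) *: p.
  by rewrite scalerA divff ?gt_eqF// scale1r subrK.
apply: cH => //; first by rewrite !ltW.
apply: rH; rewrite -ball_normE /= sub0r normrN normrZ gtr0_norm ?invr_gt0//.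
by rewrite mulrC ltr_pdivrMr// distrC mulrC.
Qed.

End Convexity.

(** * The minimum level set *)

Section ConvexBody.
Context {R : realType} {n : nat}.
Implicit Types (K : set 'rV[R]_n) (t : 'rV[R]_n).

Lemma convex_body_closed K : convex_body K -> closed K.
Proof. by case=> cK _ _; apply: compact_closed => //; exact: norm_hausdorff. Qed.

Lemma convex_body_bounded K :
  convex_body K -> exists2 M : R, 0 < M & K `<=` ball 0 M.
Proof.
case=> /compact_bounded[M [_ KM]] _ _; exists (`|M| + 2).
  by have := normr_ge0 M; lra.
move=> x Kx; rewrite -ball_normE /= sub0r normrN.
have /KM/(_ _ Kx)/= : M < `|M| + 1 by have := ler_norm M; lra.
lra.
Qed.

(** The hull equals [K] for [t] in [(1 - lambda) K], in particular at the
    origin; otherwise it has larger volume. *)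
Lemma hull_function_eq0P K (lambda : R) t :
  0 <= lambda < 1 -> convex_body K -> interior K 0 ->
  hull_function K lambda t = hull_function K lambda 0 <->
  K ((1 - lambda)^-1 *: t).
Proof.
move=> l01 bK iK; have cK := convex_body_closed bK.
have K0 : K 0 by exact: interior_subset iK.
have vK : convex_set K by case: bK.
have hullE s : K ((1 - lambda)^-1 *: s) ->
    convex_hull (K `|` homothety s lambda K) = K.
  move=> Ks; rewrite (setUidPl _ _).2 /convex_hull ?smallest_id//.
  exact: convex_homothety_sub.
have hull0 : hull_function K lambda 0 = fine (volume K).
  by rewrite /hull_function hullE// scaler0.
split=> [|Kt]; last by rewrite hull0 /hull_function hullE.
rewrite hull0; set H := convex_hull (K `|` homothety t lambda K).
rewrite /hull_function -/H => volH; apply: homothety_sub_fixpoint => // p Kp.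
have KH : K `<=` H by move=> x Kx; apply: sub_gen_smallest; left.
have Hp : H p by apply: sub_gen_smallest; right.
apply: contrapT => nKp.
have iH : interior H 0 by exact: filterS KH iK.
have [y [e e0 eHK]] :=
  convex_ball_outside cK (@convex_set_hull _ _ _) iH Hp nKp.
have [M M0 KM] := convex_body_bounded bK.
have HM : H `<=` ball 0 (`|t| + M).
  apply: smallest_sub; first exact: convex_set_ball0.
  have KM' x : K x -> `|x| < M.
    by move=> /KM; rewrite -ball_normE /= sub0r normrN.
  move=> x [/KM'|[z /KM' zM <-]]; rewrite -ball_normE /= sub0r normrN.
    by have := normr_ge0 t; lra.
  rewrite (le_lt_trans (ler_normD _ _))// ltrD2l normrZ.
  case/andP: l01 => l0 l1; rewrite ger0_norm//.
  by have := normr_ge0 z; nra.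
have tM : 0 < `|t| + M by rewrite ltr_wpDl.
by have := fine_volume_lt cK KH tM HM e0 eHK; rewrite volH ltxx.
Qed.

End ConvexBody.

(** * The gauge of a convex body *)

Section Gauge.
Context {R : realType} {n : nat}.
Variable L : set 'rV[R]_n.
Hypotheses (bL : convex_body L) (iL : interior L 0).
Implicit Types (t x : 'rV[R]_n) (a : R).

Let L0 : L 0. Proof. exact: interior_subset iL. Qed.
Let vL : convex_set L. Proof. by case: bL. Qed.

Let gauge_set t := [set a : R | 0 <= a /\ homothety 0 a L t].

Let gauge_setP t a : 0 < a -> L (a^-1 *: t) -> gauge_set t a.
Proof.
move=> a0 Lt; split; first exact: ltW.
by exists (a^-1 *: t) => //; rewrite add0r scalerA divff ?gt_eqF// scale1r.
Qed.

Let gauge_set_lb t : has_lbound (gauge_set t).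
Proof. by exists 0 => a []. Qed.

Let gauge_set_nonempty t : gauge_set t !=set0.
Proof.
have [r /= r0 rL] := (nbhs_ballP _ _).1 iL.
have a0 : 0 < (`|t| + 1) / r by rewrite divr_gt0// ltr_wpDl.
exists ((`|t| + 1) / r); apply: gauge_setP => //; apply: rL.
rewrite -ball_normE /= sub0r normrN normrZ gtr0_norm ?invr_gt0//.
rewrite mulrC ltr_pdivrMr// mulrC divfK ?gt_eqF//; lra.
Qed.

Lemma gauge_ge0 t : 0 <= gauge L t.
Proof. by apply: (lb_le_inf (gauge_set_nonempty t)) => a []. Qed.

Lemma gauge_le t a : 0 < a -> L (a^-1 *: t) -> gauge L t <= a.
Proof. by move=> a0 Lt; exact: (ge_inf (gauge_set_lb t) (gauge_setP a0 Lt)). Qed.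

Lemma gauge_lt t a : gauge L t < a -> L (a^-1 *: t).
Proof.
move=> /(inf_lt (gauge_set_nonempty t))[b [b0 [y Ly <-]] ba].
have a0 : 0 < a by exact: le_lt_trans b0 ba.
rewrite add0r scalerA; apply: convex_scale => //.
by rewrite mulr_ge0 ?invr_ge0 ?(ltW a0)//= mulrC ler_pdivrMr// mul1r ltW.
Qed.

Lemma gauge_gt0 t : t != 0 -> 0 < gauge L t.
Proof.
move=> t0; have [M M0 LM] := convex_body_bounded bL.
have a0 : 0 < `|t| / M by rewrite divr_gt0 ?normr_gt0.
rewrite (lt_le_trans a0)// leNgt; apply/negP => /gauge_lt/LM.
rewrite -ball_normE /= sub0r normrN normrZ gtr0_norm ?invr_gt0//.
by rewrite invf_div divfK ?normr_eq0// ltxx.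
Qed.

Lemma gauge0 : gauge L 0 = 0.
Proof.
apply/eqP; rewrite eq_le gauge_ge0 andbT; apply: (ge_inf (gauge_set_lb 0)).
by split=> //; exists 0; rewrite ?scaler0 ?addr0.
Qed.

Lemma gaugeZ t a : 0 <= a -> gauge L (a *: t) = a * gauge L t.
Proof.
rewrite le_eqVlt => /predU1P[<-|]; first by rewrite scale0r mul0r gauge0.
have gZ b x : 0 < b -> gauge L (b *: x) <= b * gauge L x.
  move=> b0; rewrite -ler_pdivrMl//; apply/ler_addgt0Pr => e e0.
  have xe : gauge L x < gauge L x + e by rewrite ltrDl.
  have xe0 : 0 < gauge L x + e by rewrite (le_lt_trans _ xe)// gauge_ge0.
  rewrite ler_pdivrMl//; apply: gauge_le; first by rewrite mulr_gt0.
  by rewrite scalerA invfM mulrAC mulVf ?gt_eqF// mul1r; exact: gauge_lt.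
move=> a0; apply/eqP; rewrite eq_le gZ//= -ler_pdivlMl//.
rewrite (le_trans _ (gZ a^-1 (a *: t) _)) ?invr_gt0//.
by rewrite scalerA mulVf ?gt_eqF// scale1r.
Qed.

(** The infimum defining the gauge is attained because [L] is closed: [x] is the
    limit of [x / (1 + 1 / (k + 1))], which are in [L]. *)
Lemma gauge_le1P x : gauge L x <= 1 <-> L x.
Proof.
split=> [x1|Lx]; last by apply: gauge_le => //; rewrite invr1 scale1r.
pose u k : 'rV[R]_n := (1 + k.+1%:R^-1)^-1 *: x.
apply: (closed_cvg L (convex_body_closed bL) (u_ := u) (F := \oo)).
- near=> k; apply: gauge_lt.
  by rewrite (le_lt_trans x1)// ltrDl invr_gt0.
- rewrite -[X in _ --> X]scale1r; apply: cvgZr_tmp.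
  rewrite -[X in _ --> X]invr1; apply: cvgV => //.
  rewrite -[X in _ --> X]addr0; apply: cvgD; first exact: cvg_cst.
  exact: cvg_harmonic.
Unshelve. all: by end_near. Qed.

End Gauge.

(** * Recovering the body from its hull function *)

Section Determination.
Context {R : realType} {n : nat}.
Implicit Types (K L : set 'rV[R]_n).
Variable lambda : R.
Hypothesis l01 : 0 <= lambda < 1.

Lemma mem_hull_functionP K x : convex_body K -> interior K 0 ->
  K x <-> hull_function K lambda ((1 - lambda) *: x) = hull_function K lambda 0.
Proof.
move=> bK iK; have [_ l1] := andP l01.
rewrite (hull_function_eq0P _ l01 bK iK) scalerA mulVf ?scale1r//.
by rewrite gt_eqF// subr_gt0.
Qed.

Lemma hull_function_inj K L :
  convex_body K -> convex_body L -> interior K 0 -> interior L 0 ->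
  (forall t, hull_function K lambda t = hull_function L lambda t) -> K = L.
Proof.
move=> bK bL iK iL GKL; apply/seteqP.
by split=> x; rewrite (mem_hull_functionP x bK iK)
  (mem_hull_functionP x bL iL) !GKL.
Qed.

(** Replacing [x] by the point of the ray of [v] with the same gauge for [L]
    does not affect membership in [K], and on that ray the gauges of [K] and [L]
    are proportional. *)
Lemma hull_function_gauge_homothetic K L : (0 < n)%N ->
  convex_body K -> convex_body L -> interior K 0 -> interior L 0 ->
  depends_only_on_gauge (hull_function K lambda) L -> homothetic_copy K L.
Proof.
move=> n0 bK bL iK iL GL.
pose v : 'rV[R]_n := const_mx 1.
have v0 : v != 0.
  apply/eqP => /rowP/(_ (Ordinal n0)); rewrite !mxE => /eqP.
  by rewrite oner_eq0.
have Kv0 := gauge_gt0 bK iK v0; have Lv0 := gauge_gt0 bL iL v0.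
pose mu := gauge L v / gauge K v.
have mu0 : 0 < mu by rewrite divr_gt0.
have l1_ge0 : 0 <= 1 - lambda by case/andP: l01 => _ /ltW; rewrite subr_ge0.
have KP x : K x <-> L (mu^-1 *: x).
  pose u := (gauge L x / gauge L v) *: v.
  have r0 : 0 <= gauge L x / gauge L v by rewrite divr_ge0 ?gauge_ge0// ltW.
  have ux : gauge L ((1 - lambda) *: u) = gauge L ((1 - lambda) *: x).
    by rewrite !gaugeZ// divfK// gt_eqF.
  have -> : K x <-> K u.
    rewrite (mem_hull_functionP x bK iK) (mem_hull_functionP u bK iK).
    by rewrite (GL _ _ ux).
  rewrite -(gauge_le1P bK iK) -(gauge_le1P bL iL) !gaugeZ//; last first.
    by rewrite invr_ge0 ltW.
  suff -> : gauge L x / gauge L v * gauge K v = mu^-1 * gauge L x by [].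
  by rewrite /mu invf_div; ring.
exists 0, mu; first by rewrite gt_eqF.
apply/seteqP; split=> [x /KP Lx|_ [y Ly <-]].
  by exists (mu^-1 *: x) => //; rewrite add0r scalerA divff ?gt_eqF// scale1r.
by apply/KP; rewrite add0r scalerA mulVf ?gt_eqF// scale1r.
Qed.

End Determination.

Unset Implicit Arguments.

Theorem theorem6 (R : realType) (n : nat) (lambda : R)
    (lambda_ge0 : 0 <= lambda) (lambda_lt1 : lambda < 1) (n_ge2 : (2 <= n)%N) :
  (forall K L : set 'rV[R]_n,
      convex_body K -> convex_body L ->
      interior K 0 -> interior L 0 ->
      (forall t, hull_function K lambda t = hull_function L lambda t) ->
      K = L) /\
  (forall K L : set 'rV[R]_n,
      convex_body K -> convex_body L ->
      interior K 0 -> interior L 0 ->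
      depends_only_on_gauge (hull_function K lambda) L ->
      homothetic_copy K L).
Proof.
have l01 : 0 <= lambda < 1 by rewrite lambda_ge0.
split=> K L bK bL iK iL; first exact: hull_function_inj.
by apply: hull_function_gauge_homothetic => //; exact: ltnW.
Qed.
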